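(* Let $n\ge 1$ be an integer. In the $(2n-1,2n,2n-1)$ hexagon, and likewise in the $(2n,2n-1,2n)$ hexagon, the two central triangles are covered by a (single, vertical) lozenge in exactly one-third of all the lozenge tilings of the hexagon.
   Context: An $(a,b,c)$ hexagon is a hexagon with all angles equal to $120$ degrees and side lengths $a,b,c,a,b,c$ in clockwise order, drawn so that the first side of length $b$ is the (horizontal) top side and the second side of length $b$ is the bottom side; it is subdivided into equilateral triangles of unit side by lines parallel to the sides. A lozenge is a rhombus with unit sides and angles $120$ and $60$ degrees, i.e. the union of two of the unit triangles sharing an edge; a (lozenge) tiling of a region is a partition of its unit triangles into lozenges. A vertical lozenge is one whose two triangles share a horizontal edge. For a $(k,q,k)$ hexagon the horizontal symmetry axis (joining the leftmost and rightmost vertices) has length $q+k$ and is made of $q+k$ unit edges of the triangulation. When $q+k$ is odd, the two central triangles are the two unit triangles sharing the middle unit edge of this axis; together they form the central vertical lozenge. *)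

(* Defs.v *)
From mathcomp Require Import all_boot.

Set Implicit Arguments.
Unset Strict Implicit.
Unset Printing Implicit Defensive.

(* Lattice points are written in the basis e1 = (1, 0), e2 = (1/2, sqrt 3 / 2). *)
Definition point := (nat * nat)%type.

(* The (a, b, c) hexagon, with the origin placed so that its leftmost vertex
   is (0, c).  Clockwise from there its vertices are (0, c), (0, a + c),
   (b, a + c), (b + c, a), (b + c, 0), (c, 0), so the sides are a (upper left),
   b (top), c (upper right), a (lower right), b (bottom), c (lower left). *)
Definition in_hexagon (a b c : nat) (p : point) : bool :=
  [&& p.1 <= b + c, p.2 <= a + c & c <= p.1 + p.2 <= a + b + c].

(* All the unit triangles of the parallelogram 0 <= x <= b + c, 0 <= y <= a + c,
   which contains the hexagon: each of its unit cells is cut by its short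
   diagonal into an upward (true) and a downward (false) pointing triangle. *)
Definition triangle (a b c : nat) : finType :=
  ('I_(b + c) * 'I_(a + c) * bool)%type.

Definition vertices a b c (t : triangle a b c) : seq point :=
  let: (x, y, up) := t in
  if up then [:: (x : nat, y : nat); (x.+1, y : nat); (x : nat, y.+1)]
  else [:: (x.+1, y : nat); (x : nat, y.+1); (x.+1, y.+1)].

(* As the hexagon is convex, a triangle lies in it iff its vertices do. *)
Definition hexagon (a b c : nat) : {set triangle a b c} :=
  [set t | all (in_hexagon a b c) (vertices t)].

Definition share_edge a b c (s t : triangle a b c) : bool :=
  count [in vertices t] (vertices s) == 2.

Definition is_lozenge a b c (L : {set triangle a b c}) : bool :=
  [exists s, exists t, share_edge s t && (L == [set s; t])].

Definition tilings (a b c : nat) : {set {set {set triangle a b c}}} :=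
  [set T | partition T (hexagon a b c) & [forall L in T, is_lozenge L]].

(* The horizontal axis of the (k, q, k) hexagon joins (0, k) to (q + k, k).
   For q + k odd, its middle unit edge is the one from (m, k) to (m.+1, k)
   with m = (q + k)./2. *)
Definition central_triangles (k q : nat) : {set triangle k q k} :=
  let m := (q + k)./2 in
  [set t | ((m, k) \in vertices t) && ((m.+1, k) \in vertices t)].

Definition central_tilings (k q : nat) : {set {set {set triangle k q k}}} :=
  [set T in tilings k q k | central_triangles k q \in T].

(* Main.v *)
Require Import Defs.
From mathcomp Require Import all_boot all_fingroup all_order all_algebra.
From mathcomp Require Import zify ring lra.

Import GRing.Theory Num.Theory.

(** Why one third. The horizontal axis cuts the (k, q, k) hexagon, with
    q + k = 2 M + 1, into two trapezoids; a tiling is a choice of the set S of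
    unit edges of the axis covered by vertical lozenges, followed by a tiling of
    each trapezoid deprived of the triangles at S ([matchings_cut]).

    Sweeping a trapezoid row by row, one finds that between two consecutive
    vertical lozenges a < a' across a horizontal line there is exactly one across
    the next shorter line, at some b with a < b <= a' ([row_sum]). Summing a
    determinant of binomial coefficients over such interlacing positions is a row
    operation, so the number of tilings of a trapezoid dented at
    S = {s_0 < s_1 < ...} is the determinant of the C(s_i, j) if S has k elements,
    and 0 otherwise ([trapezoid_det]). The other half is the same one rotated,
    which replaces s by 2 M - s.

    A sum over S of products of two such determinants is one determinant of
    moments ([sum_det_mul_det]). Up to a common sign, for all tilings this is
    det H with H_ij = C(2 M + 1, i + j + 1); for the tilings without the central lozenge
    the middle position M is omitted, which replaces H by H - b b^T where
    b_i = C(M, i). If H c = b then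
    det (H - b b^T) = (1 - b^T c) det H, so everything rests on b^T c = 1/3.

    Put P(z) = sum_j c_j z^(M-1-j). The equations H c = b say that
      (1 + z)^(2M+1) P(z) = A(z) + z^M (1 + z)^M + z^(2M+1) B(z)
    with A, B, P of degree less than M. Homogenized with x + y + w = 0, this is
      x^(2M+1) A + y^(2M+1) B + w^(2M+1) P = (x y w)^M
    (M is odd), which is symmetric in the three variables. As the solution is
    unique ([gap_unique]), it is invariant under the permutations of the points
    0, -1 and infinity of the projective line. Dividing it by (x y w)^M and taking
    a constant term at one of these points, the three summands give 2 g, g and 0
    where g = b^T c, and the right-hand side gives 1 ([one_third_moments]). Both
    hexagons of the theorem have M = 2 n - 1, with k = M and k = M + 1. *)

(** * Perfect matchings of a finite graph *)

Section Matchings.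
Variables (T : finType) (e : rel T).
Hypotheses (e_sym : symmetric e) (e_irr : irreflexive e).
Implicit Types (R L : {set T}) (X : {set {set T}}).

Definition edge L := [exists s, exists t, e s t && (L == [set s; t])].

Definition matchings R : {set {set {set T}}} :=
  [set X | partition X R & [forall L in X, edge L]].

Lemma edgeP L : reflect (exists s t, e s t /\ L = [set s; t]) (edge L).
Proof.
apply: (iffP existsP) => [[s /existsP[t /andP[est /eqP ->]]]|[s [t [est ->]]]].
  by exists s, t.
by exists s; apply/existsP; exists t; rewrite est eqxx.
Qed.

Lemma matchings0 : #|matchings set0| = 1.
Proof.
rewrite (_ : matchings set0 = [set set0]) ?cards1 //.
apply/setP => X; rewrite !inE partition_set0.
apply: andb_idr => /eqP ->; by apply/forall_inP => L; rewrite inE.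
Qed.

Lemma card_matchings_edge R x y : x \in R -> y \in R -> e x y ->
  #|[set X in matchings R | [set x; y] \in X]| = #|matchings (R :\: [set x; y])|.
Proof.
move=> xR yR exy.
rewrite -(card_in_imset (f := fun X => X :\ [set x; y])); last first.
  move=> X X'; rewrite !inE => /andP[_ xX] /andP[_ xX'] eqX.
  by rewrite -(setD1K xX) eqX setD1K.
apply: eq_card => X; apply/imsetP/idP => [[X0]|].
  rewrite !inE => /andP[/andP[pX0 /forall_inP eX0] xX0] ->.
  rewrite partitionD1 //=; apply/forall_inP => L.
  by rewrite !inE => /andP[_]; apply: eX0.
rewrite inE => /andP[pX /forall_inP eX].
have xyR : [set x; y] \subset R by apply/subsetP=> z /set2P[] ->.
have nxy : [set x; y] != set0 by apply/set0Pn; exists x; rewrite set21.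
have notX : [set x; y] \notin X.
  apply/negP => /(partitionS pX)/subsetP/(_ x).
  by rewrite set21 !inE eqxx /= => /(_ isT).
exists ([set x; y] |: X); last by rewrite setU1K.
rewrite !inE eqxx andbT; apply/andP; split; last first.
  apply/forall_inP => L /setU1P[->|/eX //].
  by apply/edgeP; exists x, y.
rewrite -[R](setID R [set x; y]) (setIidPr xyR) partitionU1 //.
by rewrite -setI_eq0 setIDA setDIl setDv set0I.
Qed.

(** Exactly one edge of a matching contains x; the other edges match the rest.
    All the enumeration below is driven by this recursion. *)
Lemma matchings_rec R x : x \in R ->
  #|matchings R| = \sum_(y in R | e x y) #|matchings (R :\: [set x; y])|.
Proof.
move=> xR.
transitivity (\sum_(X in matchings R) \sum_(y in R | e x y) ([set x; y] \in X : nat)).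
  rewrite -sum1_card; apply: eq_bigr => X; rewrite inE => /andP[pX /forall_inP eX].
  have : x \in cover X by rewrite (cover_partition pX).
  move=> /bigcupP[L LX xL].
  have [s [t [est Lst]]] := edgeP _ (eX _ LX).
  have [y exy Lxy] : exists2 y, e x y & L = [set x; y].
    move: xL; rewrite Lst => /set2P[] xE; first by exists t; rewrite xE.
    by exists s; rewrite xE; [rewrite e_sym | rewrite setUC].
  have yR : y \in R.
    by apply: (subsetP (partitionS pX LX)); rewrite Lxy set22.
  rewrite (bigD1 y) /=; last by rewrite yR.
  rewrite -Lxy LX big1 // => z /andP[/andP[zR exz] zy].
  case: (boolP (_ \in X)) => // xzX.
  have := partition_trivIset pX => /trivIsetP/(_ _ _ LX xzX).
  case: eqP => [Lxz _|_ /(_ isT)].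
    have: z \in L by rewrite Lxz set22.
    rewrite Lxy => /set2P[zx|/eqP]; last by rewrite (negPf zy).
    by move: exz; rewrite zx e_irr.
  rewrite -setI_eq0 => /eqP/setP/(_ x).
  by rewrite Lxy !inE eqxx.
rewrite exchange_big /=; apply: eq_bigr => y /andP[yR exy].
rewrite -card_matchings_edge // -sum1_card.
rewrite -big_mkcondr /=; apply: eq_bigl => X; by rewrite !inE.
Qed.

Lemma matchings_stuck R x : x \in R -> (forall y, y \in R -> ~~ e x y) ->
  #|matchings R| = 0.
Proof.
move=> xR no; rewrite (matchings_rec _ _ xR) big_pred0 // => y.
by apply/negP => /andP[/no/negP].
Qed.

Lemma matchings_forced R x y : x \in R -> y \in R -> e x y ->
  (forall z, z \in R -> e x z -> z = y) ->
  #|matchings R| = #|matchings (R :\: [set x; y])|.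
Proof.
move=> xR yR exy only; rewrite (matchings_rec _ _ xR) (big_pred1 y) // => z.
by apply/andP/eqP => [[zR /only ->]|->].
Qed.

Lemma matchings_fork R x y z : x \in R -> y \in R -> z \in R ->
  e x y -> e x z -> y != z -> (forall t, t \in R -> e x t -> t = y \/ t = z) ->
  #|matchings R| = #|matchings (R :\: [set x; y])|
                   + #|matchings (R :\: [set x; z])|.
Proof.
move=> xR yR zR exy exz yz only; rewrite (matchings_rec _ _ xR) (bigD1 y) ?yR //=.
congr (_ + _); apply: big_pred1 => t; apply/idP/eqP => [|->]; last first.
  by rewrite zR exz eq_sym.
by case/andP=> /andP[tR ext] ty; case: (only t tR ext) ty => ->; rewrite ?eqxx.
Qed.

Lemma matchings_imset (f : T -> T) R :
  injective f -> (forall x y, e (f x) (f y) = e x y) ->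
  #|matchings (f @: R)| = #|matchings R|.
Proof.
move=> inj_f ef; have [n] := ubnP #|R|; elim: n R => // n IHn R leRn.
have [->|[x xR]] := set_0Vmem R; first by rewrite imset0.
rewrite (matchings_rec _ _ xR) (matchings_rec _ (f x)) ?imset_f //.
rewrite [LHS]big_mkcondr /= big_imset /=; last by move=> a b _ _; apply: inj_f.
rewrite [RHS]big_mkcondr; apply: eq_bigr => y yR; rewrite ef.
case: ifP => // exy; rewrite -[RHS]IHn; last first.
  have := leRn; rewrite ltnS; apply: leq_trans; apply: proper_card.
  by apply/properP; split; [exact: subsetDl | exists x; rewrite // !inE eqxx].
congr (#|pred_of_set (matchings _)|).
apply/setP => z; apply/setDP/imsetP => [[/imsetP[t tR ->]]|[t]].
  move=> ntxy; exists t => //; rewrite !inE tR andbT.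
  by move: ntxy; rewrite !inE !(inj_eq inj_f).
rewrite !inE => /andP[ntxy tR] ->; split; first exact: imset_f.
by rewrite !(inj_eq inj_f).
Qed.

(** ** Cutting a region in two

    The only edges between A and B join d i to u i. A matching of the union is
    determined by the set S of the indices whose crossing edge it uses and by
    matchings of what S leaves of A and of B. *)
Section Cut.
Variables (I : finType) (d u : I -> T) (A B : {set T}).
Hypotheses (inj_d : injective d) (inj_u : injective u).
Hypotheses (dA : forall i, d i \in A) (uB : forall i, u i \in B).
Hypotheses (AB : [disjoint A & B]) (edu : forall i, e (d i) (u i)).
Hypothesis edgeAB : forall x y, x \in A -> y \in B -> e x y ->
  exists i, x = d i /\ y = u i.

(** Subsets of A and B are needed because the induction removes vertices of A.
    Only the sets S that they can accommodate contribute. *)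
Lemma matchings_cut_sub R1 R2 : R1 \subset A -> R2 \subset B ->
  #|matchings (R1 :|: R2)| =
  \sum_(S : {set I} | (d @: S \subset R1) && (u @: S \subset R2))
     #|matchings (R1 :\: d @: S)| * #|matchings (R2 :\: u @: S)|.
Proof.
have [n] := ubnP #|R1|; elim: n R1 R2 => // n IHn R1 R2 leR1n R1A R2B.
have [R10|[x xR1]] := set_0Vmem R1.
  rewrite {}R10 in leR1n R1A *; rewrite (big_pred1 set0) => [|S].
    by rewrite !imset0 !setD0 matchings0 set0U mul1n.
  rewrite subset0 imset_eq0; apply: andb_idr => /eqP ->; by rewrite imset0 sub0set.
have disjR z : z \in R1 -> z \in R2 -> False.
  move=> /(subsetP R1A) zA /(subsetP R2B) zB.
  by have := disjointFr AB zA; rewrite zB.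
have xA := subsetP R1A _ xR1.
have ltn1 y : #|R1 :\: [set x; y]| < n.
  have := leR1n; rewrite ltnS; apply: leq_trans; apply: proper_card.
  by apply/properP; split; [exact: subsetDl | exists x; rewrite // !inE eqxx].
rewrite (matchings_rec _ x) ?inE ?xR1 //.
rewrite (bigID (fun y => y \in R1)) /=.
rewrite [RHS](bigID (fun S : {set I} => x \in d @: S)) /= addnC; congr (_ + _).
  (* x is matched across the cut *)
  have [i xi|nox] := pickP (fun i => x == d i); last first.
    rewrite !big_pred0 // => [S|y].
      apply/negP => /andP[_ /imsetP[i _ xdi]]; by have := nox i; rewrite xdi eqxx.
    apply/negP => /andP[/andP[]]; rewrite inE => /orP[->//|yR2] exy _.
    have [i [xdi _]] := edgeAB _ _ xA (subsetP R2B _ yR2) exy.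
    by have := nox i; rewrite xdi eqxx.
  move/eqP: xi => xi.
  have xdS (S : {set I}) : (x \in d @: S) = (i \in S) by rewrite xi mem_imset.
  under [RHS]eq_bigl do rewrite xdS.
  have [uR2|uR2] := boolP (u i \in R2); last first.
    rewrite !big_pred0 // => [S|y].
      apply/negP => /andP[/andP[_ /subsetP uS] iS].
      by rewrite uS ?imset_f in uR2.
    apply/negP => /andP[/andP[]]; rewrite inE => /orP[->//|yR2] exy _.
    have [j [xj yj]] := edgeAB _ _ xA (subsetP R2B _ yR2) exy.
    by move: uR2; rewrite (inj_d _ _ (etrans (esym xi) xj)) -yj yR2.
  rewrite (big_pred1 (u i)); last first.
    move=> y; apply/idP/eqP => [|->]; last first.
      rewrite inE uR2 orbT xi edu /=; apply/negP => /disjR; exact.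
    case/andP=> /andP[]; rewrite inE => /orP[->//|yR2] exy _.
    have [j [xj yj]] := edgeAB _ _ xA (subsetP R2B _ yR2) exy.
    by rewrite yj (inj_d _ _ (etrans (esym xj) xi)).
  have ui1 : u i \notin R1 by apply/negP => /disjR; apply.
  have x2 : x \notin R2 by apply/negP; apply: disjR.
  have -> : (R1 :|: R2) :\: [set x; u i] = (R1 :\ x) :|: (R2 :\ u i).
    apply/setP => z; rewrite !inE negb_or.
    have [->|zx] := eqVneq z x; first by rewrite (negPf x2) /= andbF.
    have [->|zu] := eqVneq z (u i); first by rewrite (negPf ui1) /=.
    by [].
  rewrite IHn; first last.
  - by apply: subset_trans R2B; apply: subsetDl.
  - by apply: subset_trans R1A; apply: subsetDl.
  - by have := ltn1 x; rewrite setUid.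
  rewrite [RHS](reindex_onto (fun S : {set I} => i |: S) (fun S => S :\ i)); last first.
    by move=> S /andP[_ /setD1K].
  have eqS (S : {set I}) : ((d @: (i |: S) \subset R1) && (u @: (i |: S) \subset R2)
       && (i \in i |: S) && ((i |: S) :\ i == S))
     = (d @: S \subset R1 :\ x) && (u @: S \subset R2 :\ u i).
    rewrite !imsetU1 !subUset !sub1set -xi xR1 uR2 setU11 /= andbT.
    rewrite !subsetD1 xi !mem_imset //.
    have [iS|iS] := boolP (i \in S); last by rewrite setU1K ?eqxx ?andbT.
    rewrite !andbF; apply/negP => /andP[_ /eqP /setP/(_ i)].
    by rewrite iS !inE eqxx.
  rewrite [RHS](eq_bigl _ _ eqS); apply: eq_bigr => S _.
  by rewrite !imsetU1 !setDDl -xi.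
(* x is matched inside R1 *)
transitivity (\sum_(y in R1 | e x y)
  \sum_(S : {set I} | (d @: S \subset R1 :\: [set x; y]) && (u @: S \subset R2))
    #|matchings ((R1 :\: [set x; y]) :\: d @: S)| * #|matchings (R2 :\: u @: S)|).
  apply: eq_big => [y|y /andP[_ yR1]].
    by rewrite inE; case: (y \in R1); rewrite ?orTb ?andbT ?andbF.
  rewrite -IHn //; last by apply: subset_trans R1A; apply: subsetDl.
  congr (#|pred_of_set (matchings _)|).
  rewrite setDUl; congr (_ :|: _); apply/setDidPl.
  rewrite disjoint_sym disjoints_subset; apply/subsetP=> z.
  by rewrite !inE => /orP[]/eqP -> ; apply/negP; apply: disjR.
rewrite (exchange_big_dep (fun S : {set I} => (d @: S \subset R1) && (u @: S \subset R2)
          && (x \notin d @: S))) /=; last first.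
  move=> y S _ /andP[dS ->]; rewrite andbT; apply/andP; split.
    exact: subset_trans dS (subsetDl _ _).
  by apply/negP => /(subsetP dS); rewrite !inE eqxx.
apply: eq_bigr => S /andP[/andP[dS uS] xS].
rewrite (matchings_rec (R1 :\: d @: S) x) ?inE ?xR1 ?andbT // big_distrl /=.
apply: eq_big => [y|y _].
  rewrite uS andbT !inE.
  have -> : (d @: S \subset R1 :\: [set x; y]) = (y \notin d @: S).
    rewrite -setDDl !subsetD1 dS xS //=.
  by rewrite [_ && (_ \in R1)]andbC -!andbA [e x y && _]andbC.
by rewrite !setDDl setUC.
Qed.

Lemma matchings_cut :
  #|matchings (A :|: B)| =
  \sum_(S : {set I}) #|matchings (A :\: d @: S)| * #|matchings (B :\: u @: S)|.
Proof.
rewrite matchings_cut_sub //; apply: eq_bigl => S.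
by apply/andP; split; apply/subsetP => _ /imsetP[i _ ->].
Qed.

Lemma matchings_cut_edge i :
  #|[set X in matchings (A :|: B) | [set d i; u i] \in X]| =
  \sum_(S : {set I} | i \in S)
     #|matchings (A :\: d @: S)| * #|matchings (B :\: u @: S)|.
Proof.
have dB j : d j \notin B by rewrite (disjointFr AB).
have uA j : u j \notin A by rewrite (disjointFl AB).
rewrite card_matchings_edge ?inE ?dA ?uB ?orbT //.
have -> : (A :|: B) :\: [set d i; u i] = (A :\ d i) :|: (B :\ u i).
  apply/setP => z; rewrite !inE negb_or.
  have [->|zx] := eqVneq z (d i); first by rewrite (negPf (dB i)) /= andbF.
  by have [->|zu] := eqVneq z (u i); first by rewrite (negPf (uA i)).
rewrite matchings_cut_sub ?subsetDl //.
rewrite [RHS](reindex_onto (fun S : {set I} => i |: S) (fun S => S :\ i)); last first.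
  by move=> S /setD1K.
apply: eq_big => [S|S _]; last by rewrite !imsetU1 !setDDl.
rewrite !subsetD1 !mem_imset // setU11 /=.
have -> : d @: S \subset A by apply/subsetP => _ /imsetP[j _ ->].
have -> : u @: S \subset B by apply/subsetP => _ /imsetP[j _ ->].
rewrite /= andbb; have [iS|iS] := boolP (i \in S); last by rewrite setU1K ?eqxx.
by apply/esym/negP => /eqP /setP/(_ i); rewrite iS !inE eqxx.
Qed.
End Cut.
End Matchings.
Arguments edge {T} e L.
Arguments matchings {T} e R.

(** * Adjacency of unit triangles *)

(** The upward triangle of the cell (x, y) meets the downward triangles of its
    own cell, of the cell on its left and of the cell under it. *)
Definition up_down_adjacent x y x' y' :=
  ((x' == x) && (y' == y)) || ((x'.+1 == x) && (y' == y))
  || ((x' == x) && (y'.+1 == y)).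

Section Adj.
Variables a b c : nat.
Implicit Types (s t : triangle a b c).

Lemma share_edgeE s t : share_edge s t =
  if s.2 == t.2 then false
  else if s.2 then up_down_adjacent s.1.1 s.1.2 t.1.1 t.1.2
  else up_down_adjacent t.1.1 t.1.2 s.1.1 s.1.2.
Proof.
move: s t => [[x y] u] [[x' y'] u'].
rewrite /share_edge /up_down_adjacent; case: u; case: u' => /=; rewrite !inE /= ?xpair_eqE;
move: (nat_of_ord x) (nat_of_ord y) (nat_of_ord x') (nat_of_ord y') => {}x {}y {}x' {}y'.
all: rewrite ?eqSS; do !(case: eqP => ?; try (exfalso; lia)); try reflexivity.
Qed.

Lemma share_edge_sym : symmetric (@share_edge a b c).
Proof. by move=> s t; rewrite !share_edgeE eq_sym; case: s.2; case: t.2. Qed.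

Lemma share_edge_irr : irreflexive (@share_edge a b c).
Proof. by move=> s; rewrite share_edgeE eqxx. Qed.

Definition region (P : nat -> nat -> bool -> bool) : {set triangle a b c} :=
  [set t : triangle a b c | P t.1.1 t.1.2 t.2].

Lemma eq_region (P P' : nat -> nat -> bool -> bool) :
  (forall x y u, x < b + c -> y < a + c -> P x y u = P' x y u) ->
  region P = region P'.
Proof. by move=> eqP; apply/setP => t; rewrite !inE eqP. Qed.

Definition tri x y u (ltx : x < b + c) (lty : y < a + c) : triangle a b c :=
  (Ordinal ltx, Ordinal lty, u).

Lemma region_setD2 (P P' : nat -> nat -> bool -> bool) x y u x' y' u'
    (ltx : x < b + c) (lty : y < a + c) (ltx' : x' < b + c) (lty' : y' < a + c) :
  (forall z w v, P' z w v = [&& (z, w, v) != (x, y, u), (z, w, v) != (x', y', u')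
                               & P z w v]) ->
  region P :\: [set tri x y u ltx lty; tri x' y' u' ltx' lty'] = region P'.
Proof.
move=> eqP; apply/setP => -[[z w] v].
by rewrite !inE /= eqP negb_or -andbA !xpair_eqE.
Qed.
End Adj.
Arguments region {a b c} P.
Arguments tri {a b c} x y u ltx lty.
Arguments eq_region {a b c P P'}.

(** * Sweeping a trapezoid row by row *)
Section Rows.
Variables (k q : nat).
Local Notation T := (triangle k q k).
Local Notation e := (@share_edge k q k).
Local Notation N R := #|matchings e R|.
Let e_sym := @share_edge_sym k q k.
Let e_irr := @share_edge_irr k q k.

(** The r lowest rows of the hexagon, without the downward triangles of their
    top row whose abscissa is listed in bs: those belong to lozenges that stick
    out of the top. *)
Definition in_dented_trapezoid r (bs : seq nat) x y (u : bool) :=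
  (y < r) && (if u then k <= x + y
              else (k <= x + y + 1) && ~~ ((y.+1 == r) && (x \in bs))).

(** A row being filled from left to right. Its downward triangles listed in l are
    absent, those left of p0 and the upward ones left of p1 are already covered;
    bs lists the vertical lozenges placed so far across its lower side. The two
    states that occur are p1 = p0 + 1 (a downward triangle comes next) and
    p1 = p0 (an upward triangle comes next). *)
Definition in_row_state r p0 p1 (l bs : seq nat) x y (u : bool) :=
  in_dented_trapezoid r bs x y u
  || ((y == r) && (if u then p1 <= x else (p0 <= x) && (x \notin l))).

Definition dented_trapezoid r bs : {set T} := region (in_dented_trapezoid r bs).
Definition row_state r p0 p1 l bs : {set T} := region (in_row_state r p0 p1 l bs).

Lemma row_down_forced r p l bs : r < k -> k <= p + r + 1 -> p.+1 < q + k -> p \notin l ->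
  N (row_state r p p.+1 l bs) = N (row_state r p.+1 p.+2 l bs).
Proof.
move=> ltrk lekp ltp pl.
have ltr : r < k + k by lia.
rewrite (@matchings_forced _ _ e_sym e_irr _ (tri p r false (ltnW ltp) ltr)
           (tri p.+1 r true ltp ltr)).
- congr (#|pred_of_set (matchings _ _)|); apply: region_setD2 => z w v.
  rewrite !xpair_eqE /in_row_state /in_dented_trapezoid.
  case: v => /=; have [->|zp] := eqVneq z p; rewrite ?(negPf pl); lia.
- rewrite inE /in_row_state /= eqxx leqnn pl; lia.
- rewrite inE /in_row_state /= eqxx leqnn; lia.
- by rewrite share_edgeE /up_down_adjacent /= !eqxx /= orbT.
- move=> [[z w] v]; rewrite inE share_edgeE /in_row_state /in_dented_trapezoid /up_down_adjacent /=.
  case: v => //= zin ad.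
  have [ez ew] : val z = p.+1 /\ val w = r by rewrite /=; lia.
  by congr (_, _, _); apply: val_inj.
Qed.

Lemma row_down_stuck r p l bs : r < k -> p.+1 = q + k -> p \notin l ->
  N (row_state r p p.+1 l bs) = 0.
Proof.
move=> ltrk ltp pl; have ltr : r < k + k by lia.
have ltp' : p < q + k by rewrite -ltp.
apply: (@matchings_stuck _ _ e_sym e_irr _ (tri p r false ltp' ltr)).
  rewrite inE /in_row_state /= eqxx leqnn pl; lia.
move=> [[z w] v]; rewrite inE share_edgeE /in_row_state /in_dented_trapezoid /up_down_adjacent /=.
case: v => //= zin; have := ltn_ord z; move: (nat_of_ord z) (nat_of_ord w) zin => z' w'; lia.
Qed.

Lemma row_down_gone r p l bs : p \in l ->
  row_state r p p.+1 l bs = row_state r p.+1 p.+1 l bs.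
Proof.
move=> pl; apply: eq_region => x y u _ _; rewrite /in_row_state.
case: u => //; have [->|xp] := eqVneq x p; first by rewrite pl /= !andbF.
by rewrite (ltn_neqAle p) [p == x]eq_sym xp.
Qed.

(** An upward triangle in front is matched to its right, if the triangle there is
    present, or downwards, if there is a row below. *)
Lemma row_up r p l bs : r < k -> k <= p + r -> p < q + k -> p \notin bs ->
  N (row_state r p p l bs) = (p \notin l) * N (row_state r p.+1 p.+1 l bs)
                      + (0 < r) * N (row_state r p p.+1 l (rcons bs p)).
Proof.
move=> ltrk lekp ltp pbs; have ltr : r < k + k by lia.
have ltr1 : r.-1 < k + k by lia.
pose up := tri p r true ltp ltr; pose dn := tri p r false ltp ltr.
pose bl := tri p r.-1 false ltp ltr1.
have up_in : up \in row_state r p p l bs by rewrite inE /in_row_state /= eqxx leqnn; lia.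
have dn_in : (dn \in row_state r p p l bs) = (p \notin l).
  by rewrite inE /in_row_state /in_dented_trapezoid /= eqxx leqnn ltnn.
have bl_in : 0 < r -> bl \in row_state r p p l bs.
  move=> r0; rewrite inE /in_row_state /in_dented_trapezoid /= (negPf pbs) andbF; lia.
have up_dn : e up dn by rewrite share_edgeE /up_down_adjacent /= !eqxx.
have up_bl : 0 < r -> e up bl.
  by move=> r0; rewrite share_edgeE /up_down_adjacent /= !eqxx /= prednK ?eqxx ?orbT.
have only t : t \in row_state r p p l bs -> e up t -> t = dn \/ (0 < r) /\ t = bl.
  case: t => [[z w] v]; rewrite inE share_edgeE /in_row_state /in_dented_trapezoid /up_down_adjacent /=.
  case: v => //= zin ad.
  have [ez ew] : val z = p /\ (val w = r \/ 0 < r /\ val w = r.-1) by rewrite /=; lia.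
  by case: ew => [ew|[r0 ew]]; [left | right; split=> //]; congr (_, _, _); apply: val_inj.
have Dn : row_state r p p l bs :\: [set up; dn] = row_state r p.+1 p.+1 l bs.
  apply: region_setD2 => z w v; rewrite !xpair_eqE /in_row_state /in_dented_trapezoid.
  by case: v => /=; lia.
have Bl : 0 < r -> row_state r p p l bs :\: [set up; bl] = row_state r p p.+1 l (rcons bs p).
  move=> r0; apply: region_setD2 => z w v; rewrite !xpair_eqE /in_row_state /in_dented_trapezoid.
  case: v => /=; rewrite ?mem_rcons ?inE ?eqb_id ?eqbF_neg /=; lia.
have dn_bl : 0 < r -> dn != bl.
  by move=> r0; apply/eqP => /(congr1 (fun t : T => val t.1.2)) /=; lia.
have [pl|pl] := boolP (p \in l); have [r0|r0] := posnP r; rewrite /= ?mul1n ?mul0n ?addn0 ?add0n.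
- apply: (@matchings_stuck _ _ e_sym e_irr _ up) => // t tin; apply/negP => et.
  case: (only t tin et) => [tE|[]]; last by rewrite r0.
  by move: tin; rewrite tE dn_in pl.
- rewrite -Bl // (@matchings_forced _ _ e_sym e_irr _ up bl) ?bl_in ?up_bl // => t tin et.
  case: (only t tin et) => [tE|[]//].
  by move: tin; rewrite tE dn_in pl.
- rewrite -Dn (@matchings_forced _ _ e_sym e_irr _ up dn) ?dn_in // => t tin et.
  by case: (only t tin et) => [|[]] //; rewrite r0.
rewrite -Bl // -Dn (@matchings_fork _ _ e_sym e_irr _ up dn bl) ?bl_in ?dn_in ?up_bl ?dn_bl //.
by move=> t tin et; case: (only t tin et) => [|[]]; [left | right].
Qed.

(** A downward triangle in front forces a run of lozenges that goes on until the
    first absent triangle a. *)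
Lemma row_skip r p a l bs : r < k -> k <= p + r + 1 -> p <= a -> a < q + k ->
  path ltn a l -> N (row_state r p p.+1 (a :: l) bs) = N (row_state r a.+1 a.+1 l bs).
Proof.
move=> ltrk lekp lepa lta pal; move: lekp lepa.
have alt x : x \in l -> a < x by move/(allP (order_path_min ltn_trans pal)).
have [n] := ubnP (a - p); elim: n p => // n IHn p ltn lekp lepa.
have [ap|ltpa] := eqVneq p a.
  rewrite ap row_down_gone ?mem_head //; congr (#|pred_of_set (matchings _ _)|).
  apply: eq_region => x y u _ _; rewrite /in_row_state; case: u => //.
  by rewrite inE; case: (ltngtP x a) => // ; rewrite ?andbF.
have pal' : p \notin a :: l.
  by rewrite inE (negPf ltpa) /=; apply/negP => /alt; lia.
rewrite row_down_forced //; last lia.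
by apply: IHn; lia.
Qed.

(** Such a run cannot stop before the right end of the row, where its last
    downward triangle stays alone. *)
Lemma row_skip_nil r p bs : r < k -> k <= p + r + 1 -> p < q + k ->
  N (row_state r p p.+1 [::] bs) = 0.
Proof.
move=> ltrk lekp ltp; have [n] := ubnP (q + k - p).
elim: n p lekp ltp => // n IHn p lekp ltp ltn.
have [pE|pE] := eqVneq p.+1 (q + k); first exact: row_down_stuck.
rewrite row_down_forced //; last lia.
by apply: IHn; lia.
Qed.

Lemma row_end r p bs : r < k -> k <= p + r -> p <= q + k -> all (ltn^~ p) bs ->
  N (row_state r p p [::] bs) = N (dented_trapezoid r bs).
Proof.
move=> ltrk lekp lep; have [n] := ubnP (q + k - p).
elim: n p lekp lep => // n IHn p lekp lep ltn lebs.
have [pE|pE] := eqVneq p (q + k).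
  congr (#|pred_of_set (matchings _ _)|); apply: eq_region => x y u ltx _.
  by rewrite /in_row_state pE in_nil andbT leqNgt ltx /= if_same andbF orbF.
have pbs : p \notin bs by apply/negP => /(allP lebs); rewrite /= ltnn.
rewrite row_up // ?row_skip_nil //; try lia.
rewrite mul1n muln0 addn0; apply: IHn; try lia.
by apply: sub_all lebs => x /=; lia.
Qed.

(** Interlacing: exactly one vertical lozenge of the lower side lies between two
    consecutive absent triangles. *)
Lemma row_sum r p a l bs : r < k -> k <= p + r -> p <= a -> a < q + k ->
  path ltn a l -> all (ltn^~ p) bs ->
  N (row_state r p p (a :: l) bs) =
  (0 < r) * \sum_(p <= x < a.+1) N (row_state r a.+1 a.+1 l (rcons bs x)).
Proof.
move=> ltrk lekp lepa lta pal; move: lekp lepa.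
have alt x : x \in l -> a < x by move/(allP (order_path_min ltn_trans pal)).
have [n] := ubnP (a - p); elim: n p => // n IHn p ltn lekp lepa lebs.
have pbs : p \notin bs by apply/negP => /(allP lebs); rewrite /= ltnn.
rewrite row_up //; last lia.
rewrite row_skip //; last lia.
rewrite big_ltn ?ltnS // mulnDr [RHS]addnC; congr (_ + _).
have [ap|ltpa] := eqVneq p a.
  by rewrite ap mem_head mul0n big_geq ?muln0.
have pal' : p \notin a :: l.
  by rewrite inE (negPf ltpa) /=; apply/negP => /alt; lia.
rewrite pal' mul1n IHn //; try lia.
by apply: sub_all lebs => x /=; lia.
Qed.
End Rows.

(** * Determinants given by a list of rows *)
Section RowDet.
Local Open Scope ring_scope.
Implicit Types (vs ws : seq (nat -> rat)) (v : nat -> rat).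

(** The value 0 for lists of the wrong length makes the determinant formula for
    trapezoids true for every number of dents. *)
Definition rowdet r vs : rat :=
  if size vs == r then \det (\matrix_(i < r, j < r) nth (fun=> 0) vs i j) else 0.

Lemma eq_rowdet r vs ws : size vs = size ws ->
  (forall i j, nth (fun=> 0) vs i j = nth (fun=> 0) ws i j) ->
  rowdet r vs = rowdet r ws.
Proof.
rewrite /rowdet => -> eqvw; case: ifP => // _; congr (\det _).
by apply/matrixP => i j; rewrite !mxE eqvw.
Qed.

Lemma rowdet_sum r vs ws (I : Type) (s : seq I) (v : I -> nat -> rat) :
  \sum_(x <- s) rowdet r (vs ++ v x :: ws)
  = rowdet r (vs ++ (fun j => \sum_(x <- s) v x j) :: ws).
Proof.
rewrite /rowdet !size_cat /=.
have [sz|/negPf sz] := eqVneq; last first.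
  by rewrite big1 // => x _; rewrite size_cat /= sz.
have ltr : (size vs < r)%N by rewrite -sz; lia.
pose i0 := Ordinal ltr.
rewrite (expand_det_row _ i0).
under eq_bigr => x _.
  rewrite size_cat /= sz eqxx (expand_det_row _ i0).
  over.
rewrite exchange_big /=; apply: eq_bigr => j _.
rewrite mxE nth_cat ltnn subnn /= mulr_suml; apply: eq_bigr => x _.
rewrite mxE nth_cat ltnn subnn /=; congr (_ * (_ * \det _)).
apply/matrixP => i l; rewrite !mxE !nth_cat; case: ltnP => // lei.
have: lift i0 i != size vs :> nat by rewrite eq_sym; apply: neq_lift.
move: lei; rewrite leq_eqVlt eq_sym => /orP[/eqP->|]; first by rewrite eqxx.
by move=> lti _; rewrite -(subnSK lti).
Qed.

(** Subtracting from each row the one above turns the first column, all ones, into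
    a unit vector; the determinant reduces to the minor of the differences. *)
Lemma rowdet_diff r (f : nat -> nat -> rat) a l : (forall x, f x 0%N = 1) ->
  rowdet r (pairmap (fun x y j => f y j.+1 - f x j.+1) a l)
  = rowdet r.+1 [seq f x | x <- a :: l].
Proof.
move=> f0; rewrite /rowdet /= size_map size_pairmap eqSS.
case: eqP => // sz.
set A := \matrix_(i, j) nth _ (f a :: _) i j.
have AE i j : A i j = f (nth 0 (a :: l) i) j.
  rewrite mxE; case: i => -[|i] lti //=.
  by rewrite (nth_map 0%N) // sz -ltnS.
pose L : 'M[rat]_r.+1 := \matrix_(i, j) ((i == j)%:R - (i == j.+1 :> nat)%:R).
have detL : \det L = 1.
  rewrite det_trig; last first.
    apply/is_trig_mxP => i j ltij; rewrite mxE.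
    rewrite -val_eqE /= (ltn_eqF ltij) (ltn_eqF (_ : (i < j.+1)%N)) ?subr0 //.
    exact: ltnW.
  by apply: big1 => i _; rewrite mxE eqxx ltn_eqF ?subr0.
have LA i j : (L *m A) i j =
   if i == 0 :> nat then A i j else A i j - f (nth 0 (a :: l) i.-1) j.
  rewrite mxE; under eq_bigr do rewrite mxE mulrBl.
  rewrite sumrB (bigD1 i) //= eqxx mul1r big1 ?addr0; last first.
    by move=> m /negPf mi; rewrite eq_sym mi mul0r.
  case: eqP => [i0|/eqP]; last rewrite -lt0n => i0.
    by rewrite big1 ?subr0 // => m _; rewrite i0 mul0r.
  have lti : (i.-1 < r.+1)%N by apply: leq_ltn_trans (ltn_ord i); lia.
  rewrite (bigD1 (Ordinal lti)) //= prednK // eqxx mul1r big1 ?addr0 ?AE //.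
  move=> m; rewrite -val_eqE /= => mi; rewrite (_ : _ == _ = false) ?mul0r //.
  by apply/eqP => im; case/eqP: mi; rewrite im.
have <- : \det (L *m A) = \det A by rewrite det_mulmx detL mul1r.
rewrite (expand_det_col _ 0) big_ord_recl big1 ?addr0; last first.
  by move=> i _; rewrite LA /= AE /= !f0 subrr mul0r.
rewrite LA /= AE f0 mul1r /cofactor expr0 mul1r; congr (\det _).
apply/matrixP => i j; rewrite !mxE /=.
have := LA (lift 0 i) (lift 0 j); rewrite mxE AE => ->.
by rewrite /= (nth_pairmap 0%N) ?sz.
Qed.
End RowDet.

(** * Sums of products of two determinants *)
Section CauchyBinet.
Local Open Scope ring_scope.
Variables (k N : nat).
Implicit Types (Q S : {set 'I_N}).

Lemma sum_det_rows Q (f : 'I_k -> 'I_N -> 'I_k -> rat) :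
  \sum_(s : {ffun 'I_k -> 'I_N} | s \in ffun_on (mem Q))
     \det (\matrix_(i, j) f i (s i) j)
  = \det (\matrix_(i, j) \sum_(x in Q) f i x j).
Proof.
rewrite exchange_big /=; apply: eq_bigr => p _; rewrite -mulr_sumr; congr (_ * _).
transitivity (\prod_i \sum_(x in Q) f i x (p i)).
  rewrite bigA_distr_big; apply: eq_bigr => s _.
  by apply: eq_bigr => i _; rewrite mxE.
by apply: eq_bigr => i _; rewrite mxE.
Qed.

(** The Cauchy-Binet identity in the form of Andreief, over all functions s
    instead of all sets of size k: expanding the first determinant and absorbing
    its factors in the rows of the second gives k! times the same term. *)
Lemma sum_det_mul_det Q (f g : nat -> 'I_N -> rat) :
  \sum_(s : {ffun 'I_k -> 'I_N} | s \in ffun_on (mem Q))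
     \det (\matrix_(i < k, j < k) f j (s i)) * \det (\matrix_(i < k, j < k) g j (s i))
  = (k`!)%:R * \det (\matrix_(i < k, j < k) \sum_(x in Q) f i x * g j x).
Proof.
set G := \matrix_(i, j) _.
transitivity (\sum_(p : 'S_k) (-1) ^+ p *
   \sum_(s : {ffun 'I_k -> 'I_N} | s \in ffun_on (mem Q))
     \det (\matrix_(i < k, j < k) (f (p i) (s i) * g j (s i)))).
  under [RHS]eq_bigr do rewrite mulr_sumr.
  rewrite [RHS]exchange_big /=; apply: eq_bigr => s _.
  rewrite mulr_suml; apply: eq_bigr => p _; rewrite -mulrA; congr (_ * _).
  have -> : \prod_i (\matrix_(i < k, j < k) f j (s i)) i (p i)
          = \det (diag_mx (\row_i f (p i) (s i))).
    by rewrite det_diag; apply: eq_bigr => i _; rewrite !mxE.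
  rewrite -det_mulmx.
  congr (\det _); apply/matrixP => i j.
  by rewrite mul_diag_mx !mxE.
rewrite mulr_natl -card_Sn -sumr_const; apply: eq_bigr => p _.
rewrite (sum_det_rows Q (fun i x j => f (p i) x * g j x)).
have -> : (\matrix_(i, j) \sum_(x in Q) f (p i) x * g j x) = row_perm p G.
  by apply/matrixP => i j; rewrite !mxE.
by rewrite row_permE det_mulmx det_perm mulrA -expr2 sqrr_sign mul1r.
Qed.

Definition binomial_det (l : seq nat) : rat :=
  if size l == k then \det (\matrix_(i < k, j < k) 'C(nth 0 l i, j)%:R) else 0.

Definition positions S : seq nat := [seq val x | x <- enum S].

Lemma size_positions S : size (positions S) = #|S|.
Proof. by rewrite size_map cardE. Qed.

Lemma mem_positions S (x : 'I_N) : (val x \in positions S) = (x \in S).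
Proof. by rewrite mem_map ?mem_enum //; apply: val_inj. Qed.

Lemma sorted_positions S : sorted ltn (positions S).
Proof.
apply: (@subseq_sorted _ _ ltn_trans _ (map val (enum 'I_N))).
  by apply: map_subseq; rewrite enumT filter_subseq.
by rewrite val_enum_ord iota_ltn_sorted.
Qed.

Lemma positions_rev S :
  positions [set rev_ord x | x in S] = rev [seq val (rev_ord x) | x <- enum S].
Proof.
apply: (irr_sorted_eq ltn_trans ltnn); first exact: sorted_positions.
  rewrite rev_sorted sorted_map.
  have := sorted_positions S; rewrite sorted_map; apply: sub_sorted => x y /=.
  have := ltn_ord y; lia.
move=> n; rewrite mem_rev; apply/mapP/mapP => [[x]|[x]].
  by rewrite mem_enum => /imsetP[y yS ->] ->; exists y; rewrite ?mem_enum.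
rewrite mem_enum => xS ->; exists (rev_ord x) => //.
by rewrite mem_enum imset_f.
Qed.

Let rev_sign : rat := (-1) ^+ perm (@rev_ord_inj k).

(** Any enumeration s of S may replace the increasing one, as the two determinants
    change by the same sign. The constant sign comes from the reversal of the
    order in the second one. *)
Lemma binomial_det_image (s : 'I_k -> 'I_N) S : injective s ->
  [set s i | i in 'I_k] = S ->
  binomial_det (positions S) * binomial_det (positions [set rev_ord x | x in S]) =
  rev_sign * (\det (\matrix_(i < k, j < k) 'C(s i, j)%:R) *
              \det (\matrix_(i < k, j < k) 'C(N - (s i).+1, j)%:R)).
Proof.
move=> inj_s sS; have cS : #|S| = k by rewrite -sS card_imset // card_ord.
have cE : size (enum S) = k by rewrite -cardE.
have iS i : s i \in enum S by rewrite mem_enum -sS imset_f.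
have lt_ind i : (index (s i) (enum S) < k)%N by rewrite -[X in (_ < X)%N]cE index_mem.
pose p0 i := Ordinal (lt_ind i).
have inj_p0 : injective p0.
  move=> i j /(congr1 val) /= eqij; apply: inj_s.
  by rewrite -(nth_index (s i) (iS i)) eqij nth_index.
pose p := perm inj_p0.
have posE i : nth 0 (positions S) (p i) = s i.
  by rewrite permE (nth_map (s i)) ?cE //= nth_index.
rewrite /binomial_det !size_positions card_imset; last exact: rev_ord_inj.
rewrite cS eqxx.
have -> : \matrix_(i < k, j < k) 'C(s i, j)%:R =
   row_perm p (\matrix_(i < k, j < k) 'C(nth 0 (positions S) i, j)%:R) :> 'M[rat]_k.
  by apply/matrixP => i j; rewrite !mxE posE.
have -> : \matrix_(i < k, j < k) 'C(N - (s i).+1, j)%:R =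
   row_perm p (\matrix_(i < k, j < k) 'C(N - (nth 0 (positions S) i).+1, j)%:R)
   :> 'M[rat]_k.
  by apply/matrixP => i j; rewrite !mxE posE.
have -> : \matrix_(i < k, j < k) 'C(nth 0 (positions [set rev_ord x | x in S]) i, j)%:R =
   row_perm (perm (@rev_ord_inj k))
     (\matrix_(i < k, j < k) 'C(N - (nth 0 (positions S) i).+1, j)%:R) :> 'M[rat]_k.
  apply/matrixP => i j; rewrite !mxE permE positions_rev.
  rewrite nth_rev ?size_map ?cE // (nth_map (s i)) ?cE ?rev_ord_proof //=.
  by rewrite (nth_map (s i)) ?cE ?rev_ord_proof.
rewrite !row_permE !det_mulmx !det_perm -/rev_sign.
have := sqrr_sign rat p; set e := _ ^+ p; rewrite expr2 => ee.
set X := \det _; set Z := \det _.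
by rewrite -[LHS]mul1r -ee; ring.
Qed.

(** Functions that are not injective give zero, and each set of size k is the image
    of k! injective ones. *)
Lemma sum_binomial_det Q :
  \sum_(S : {set 'I_N} | S \subset Q)
     binomial_det (positions S) * binomial_det (positions [set rev_ord x | x in S])
  = rev_sign * \det (\matrix_(i < k, j < k)
       \sum_(x in Q) 'C(x, i)%:R * 'C(N - x.+1, j)%:R).
Proof.
have k0 : (k`!)%:R != 0 :> rat by rewrite pnatr_eq0 -lt0n fact_gt0.
apply: (mulfI k0); rewrite [RHS]mulrCA.
rewrite -(sum_det_mul_det Q (fun j x => 'C(x, j)%:R) (fun j x => 'C(N - x.+1, j)%:R)).
pose g (s : 'I_k -> 'I_N) : rat := \det (\matrix_(i < k, j < k) 'C(s i, j)%:R) *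
              \det (\matrix_(i < k, j < k) 'C(N - (s i).+1, j)%:R).
rewrite (bigID (fun s : {ffun 'I_k -> 'I_N} => injectiveb s)) /=.
rewrite [X in _ + X]big1 ?addr0; last first.
  move=> s /andP[_ /injectivePn[i [j ij sij]]].
  rewrite (determinant_alternate ij) ?mul0r // => l; by rewrite !mxE sij.
rewrite (partition_big (fun s : {ffun 'I_k -> 'I_N} => [set s i | i in 'I_k])
          (fun S => (S \subset Q) && (#|S| == k))) /=; last first.
  move=> s /andP[/ffun_onP sQ /injectiveP inj_s].
  rewrite card_imset // card_ord eqxx andbT.
  by apply/subsetP => _ /imsetP[i _ ->]; apply: sQ.
rewrite !mulr_sumr [LHS](bigID (fun S : {set _} => #|S| == k)) /=.
rewrite [X in _ + X]big1 ?addr0; last first.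
  by move=> S /andP[_ ck]; rewrite /binomial_det size_positions (negPf ck) mul0r mulr0.
apply: eq_bigr => S /andP[SQ /eqP cS].
transitivity (\sum_(s : {ffun 'I_k -> 'I_N} | s \in [set s in ffun_on (mem S) | injectiveb s])
    binomial_det (positions S) * binomial_det (positions [set rev_ord x | x in S])).
  by rewrite sumr_const card_inj_ffuns_on card_ord cS ffactnn mulr_natl.
rewrite mulr_sumr; apply: eq_big => [s|s].
  rewrite inE; apply/andP/andP => [[/ffun_onP sS inj_s]|[/andP[sQ inj_s]]].
    have /eqP imS : [set s i | i in 'I_k] == S.
      rewrite eqEcard card_imset ?card_ord ?cS ?leqnn ?andbT; last exact/injectiveP.
      by apply/subsetP => _ /imsetP[i _ ->]; apply: sS.
    split; last exact/eqP; apply/andP; split=> //.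
    by apply/ffun_onP => i; apply: (subsetP SQ); apply: sS.
  move=> /eqP <-; split=> //; by apply/ffun_onP => i; apply: imset_f.
rewrite inE => /andP[/ffun_onP sS /injectiveP inj_s].
apply: binomial_det_image => //; apply/eqP; rewrite eqEcard card_imset // card_ord cS leqnn andbT.
by apply/subsetP => _ /imsetP[i _ ->]; apply: sS.
Qed.
End CauchyBinet.
Arguments positions {N} S.

(** * The number of tilings as a sum over the axis *)
Section Trapezoid.
Local Open Scope ring_scope.
Variables (k q : nat).
Local Notation T := (triangle k q k).
Local Notation e := (@share_edge k q k).
Local Notation N R := (#|matchings e R|%:R : rat).

(** x + r - k is the rank of the downward triangle of abscissa x in row r - 1,
    which starts at abscissa k - r. *)
Definition binomial_row r x j : rat := 'C(x + r - k, j)%:R.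

(** Hockey-stick summation; the ranks increase by one from a row to the next. *)
Lemma sum_binomial_row r a b j : (k <= a + r + 1)%N -> (a <= b)%N ->
  \sum_(a.+1 <= x < b.+1) binomial_row r x j =
  binomial_row r.+1 b j.+1 - binomial_row r.+1 a j.+1.
Proof.
move=> leka leab; rewrite -(telescope_sumr (fun x => binomial_row r.+1 x j.+1)) //.
rewrite big_add1 /=; apply: eq_big_nat => x /andP[leax ltxb].
rewrite /binomial_row -natrB ?leq_bin2l //; last lia.
have -> : (x.+1 + r.+1 - k = (x.+1 + r - k).+1)%N by lia.
have -> : (x + r.+1 - k = x.+1 + r - k)%N by lia.
by rewrite binS addKn.
Qed.

(** Induction on the number of rows. By interlacing, the vertical lozenges below
    the top row range over a product of intervals, and summing over each of them
    turns a row of binomials into a difference of two rows of longer binomials;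
    [rowdet_diff] recognizes the determinant of the next size. *)
Lemma trapezoid_det r l : (r <= k)%N -> sorted ltn l ->
  all (fun x => (k <= x + r)%N && (x < q + k)%N) l -> (r = 0%N -> l = [::]) ->
  N (dented_trapezoid k q r l) = rowdet r [seq binomial_row r x | x <- l].
Proof.
elim: r l => [|r IHr] l lerk srt rng l0.
  rewrite l0 // /rowdet /= det_mx00.
  rewrite (_ : dented_trapezoid k q 0 [::] = set0) ?matchings0 //.
have ltrk : (r < k)%N by [].
pose p0 := (k - r.+1)%N.
have stateE m : dented_trapezoid k q r.+1 m = row_state k q r p0 p0.+1 m [::].
  apply: eq_region => x y u _ _; rewrite /in_row_state /in_dented_trapezoid !in_nil andbF /= /p0.
  case: u; lia.
rewrite stateE; case: l => [|a l] in srt rng l0 *.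
  rewrite row_skip_nil /p0; try lia.
  by rewrite /rowdet.
move: rng => /= /andP[/andP[leka lta] rng].
rewrite row_skip //; try (rewrite /p0; lia).
rewrite -rowdet_diff; last by move=> x; rewrite /binomial_row bin0.
(* The rows of bs are already chosen; each remaining one is replaced by the sum
   over its interval. *)
have gen bs : pairwise ltn (rcons bs a.+1) ->
   all (fun x => (k <= x + r)%N && (x < q + k)%N) bs -> (r = 0%N -> bs = [::]) ->
   N (row_state k q r a.+1 a.+1 l bs) =
   rowdet r ([seq binomial_row r x | x <- bs] ++
     pairmap (fun x y j => binomial_row r.+1 y j.+1 - binomial_row r.+1 x j.+1) a l).
  elim: l a leka lta srt rng bs {l0} => [|a' l IHl] a leka lta srt rng bs sbs rbs bs0.
    move: sbs; rewrite pairwise_rcons => /andP[ltbs sbs].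
    rewrite row_end ?cats0 //; try lia.
    by apply: IHr; rewrite ?sorted_pairwise ?(ltnW ltrk) //; apply: ltn_trans.
  move: srt rng => /= /andP[ltaa' srt] /andP[/andP[leka' lta'] rng].
  have /andP[ltbs pbs] : all (ltn^~ a.+1) bs && pairwise ltn bs.
    by rewrite -pairwise_rcons.
  rewrite row_sum //; try lia.
  have [r0|r0] := posnP r.
    by rewrite /= mul0n /rowdet ifN // r0 size_cat addnC.
  rewrite mul1n natr_sum.
  transitivity (\sum_(a.+1 <= x < a'.+1) rowdet r ([seq binomial_row r x | x <- bs] ++
     binomial_row r x :: pairmap (fun x y j => binomial_row r.+1 y j.+1 - binomial_row r.+1 x j.+1) a' l)).
    rewrite big_nat [RHS]big_nat; apply: eq_bigr => x /andP[leax ltxa].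
    rewrite IHl //; last by move=> r0'; rewrite r0' in r0.
    - by rewrite map_rcons cat_rcons.
    - rewrite !pairwise_rcons all_rcons pbs !andbT -andbA -all_predI.
      by rewrite /= ltxa; apply: sub_all ltbs => z /=; lia.
    rewrite all_rcons rbs andbT; lia.
  rewrite rowdet_sum; apply: eq_rowdet => [|i j]; first by rewrite !size_cat.
  rewrite !nth_cat; case: ltnP => // _; case: (i - _)%N => //=.
  rewrite sum_binomial_row //; lia.
by rewrite gen.
Qed.

Hypothesis k_gt0 : (0 < k)%N.
Implicit Types (S : {set 'I_(q + k)}) (x : 'I_(q + k)) (s t : T).

Let ltd : (k.-1 < k + k)%N. Proof. lia. Qed.
Let ltu : (k < k + k)%N. Proof. lia. Qed.

(** The triangles under and above the x-th unit edge of the axis. *)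
Definition axis_down (x : 'I_(q + k)) : T := (x, Ordinal ltd, false).
Definition axis_up (x : 'I_(q + k)) : T := (x, Ordinal ltu, true).
(** The half-turn around the centre of the hexagon. *)
Definition rotate (t : T) : T := (rev_ord t.1.1, rev_ord t.1.2, ~~ t.2).

Lemma rotateK : involutive rotate.
Proof. by move=> [[x y] u]; rewrite /rotate /= !rev_ordK negbK. Qed.

Lemma rotate_edge s t : e (rotate s) (rotate t) = e s t.
Proof.
move: s t => [[x y] u] [[x' y'] u']; rewrite !share_edgeE /rotate /up_down_adjacent /=.
have := ltn_ord x; have := ltn_ord x'; have := ltn_ord y; have := ltn_ord y'.
move: (nat_of_ord x) (nat_of_ord y) (nat_of_ord x') (nat_of_ord y').
by move=> a b a' b' *; case: u; case: u' => //=; lia.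
Qed.

Lemma rotate_axis_down x : rotate (axis_down x) = axis_up (rev_ord x).
Proof. by congr (_, _, _); apply: val_inj => /=; lia. Qed.

Lemma mem_hexagon t : (t \in hexagon k q k) =
  if t.2 then (k <= t.1.1 + t.1.2)%N && (t.1.1 + t.1.2 + 1 <= q + k + k)%N
  else (k <= t.1.1 + t.1.2 + 1)%N && (t.1.1 + t.1.2 + 2 <= q + k + k)%N.
Proof.
move: t => [[x y] u]; rewrite inE /=.
have := ltn_ord x; have := ltn_ord y.
by case: u; rewrite /= /in_hexagon /=; lia.
Qed.

Definition lower : {set T} := dented_trapezoid k q k [::].
Definition upper : {set T} := [set rotate t | t in lower].

Lemma mem_lower t : (t \in lower) =
  (t.1.2 < k)%N && (k <= t.1.1 + t.1.2 + ~~ t.2)%N.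
Proof.
rewrite inE /in_dented_trapezoid in_nil andbF andbT.
by case: t.2; rewrite ?addn0 ?addn1.
Qed.

Lemma mem_rotate (R : {set T}) t : (t \in [set rotate s | s in R]) = (rotate t \in R).
Proof. by rewrite -{1}[t]rotateK mem_imset //; apply: inv_inj rotateK. Qed.

Lemma mem_upper t : (t \in upper) = (rotate t \in lower).
Proof. exact: mem_rotate. Qed.

Lemma hexagonE : hexagon k q k = lower :|: upper.
Proof.
apply/setP => -[[x y] u]; rewrite mem_hexagon inE mem_upper !mem_lower /=.
have := ltn_ord x; have := ltn_ord y; case: u => /=; lia.
Qed.

Lemma lower_setD S : lower :\: [set axis_down x | x in S] =
  dented_trapezoid k q k (positions S).
Proof.
apply/setP => t; rewrite in_setD mem_lower [in RHS]inE /in_dented_trapezoid.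
have -> : (t \in [set axis_down x | x in S]) =
    [&& ~~ t.2, t.1.2.+1 == k & t.1.1 \in S].
  move: t => [[x y] u] /=; apply/imsetP/and3P => [[z zS [-> -> ->]]|[]].
    by split=> //=; rewrite prednK.
  case: u => // _ /eqP yk xS; exists x => //.
  by congr (_, _, _); apply: val_inj; rewrite /=; lia.
rewrite mem_positions; case: t.2 => /=; rewrite ?addn0 ?addn1 //.
by rewrite andbC andbA.
Qed.

Lemma upper_setD S : upper :\: [set axis_up x | x in S] =
  [set rotate t | t in lower :\: [set axis_down x | x in [set rev_ord x | x in S]]].
Proof.
have <- : [set rotate t | t in [set axis_down x | x in [set rev_ord x | x in S]]]
        = [set axis_up x | x in S].
  by rewrite -!imset_comp; apply: eq_imset => x /=; rewrite rotate_axis_down rev_ordK.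
by apply/setP => t; rewrite mem_rotate !in_setD mem_upper mem_rotate.
Qed.

Lemma card_lower S :
  N (lower :\: [set axis_down x | x in S]) = binomial_det k (positions S).
Proof.
rewrite lower_setD trapezoid_det ?sorted_positions //; last first.
- by move=> k0; move: k_gt0; rewrite [X in (_ < X)%N]k0.
- by apply/allP => _ /mapP[x _ ->]; rewrite leq_addl /=.
rewrite /rowdet /binomial_det size_map; case: eqP => // sz; congr (\det _).
apply/matrixP => i j; rewrite !mxE (nth_map 0%N) ?sz //.
by rewrite /binomial_row addnK.
Qed.

Lemma card_upper S : N (upper :\: [set axis_up x | x in S]) =
  binomial_det k (positions [set rev_ord x | x in S]).
Proof.
rewrite upper_setD matchings_imset ?card_lower //.
- exact: share_edge_sym.
- exact: share_edge_irr.
- exact: inv_inj rotateK.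
exact: rotate_edge.
Qed.

Lemma lower_upper_disjoint : [disjoint lower & upper].
Proof.
rewrite -setI_eq0; apply/eqP/setP => t; rewrite in_setI mem_upper !mem_lower /= in_set0.
apply/negP => /andP[/andP[h _] /andP[h' _]]; move: h h'.
have := ltn_ord t.1.2; lia.
Qed.

Lemma axis_crossing s t : s \in lower -> t \in upper -> e s t ->
  exists x, s = axis_down x /\ t = axis_up x.
Proof.
move: s t => [[x y] u] [[x' y'] u'].
rewrite mem_upper !mem_lower share_edgeE /up_down_adjacent /=.
have := ltn_ord y'; have := ltn_ord x'; case: u; case: u' => //= *.
  exfalso; lia.
exists x; split; congr (_, _, _); apply: val_inj => /=; lia.
Qed.

Lemma axis_down_lower x : axis_down x \in lower.
Proof. by rewrite mem_lower /=; lia. Qed.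

Lemma axis_up_upper x : axis_up x \in upper.
Proof. by rewrite mem_upper mem_lower /=; have := ltn_ord x; lia. Qed.

Lemma axis_edge x : e (axis_down x) (axis_up x).
Proof. by rewrite share_edgeE /up_down_adjacent /= prednK // !eqxx !orbT. Qed.

Lemma axis_down_inj : injective axis_down. Proof. by move=> x y []. Qed.
Lemma axis_up_inj : injective axis_up. Proof. by move=> x y []. Qed.

Lemma card_tilings : #|tilings k q k|%:R =
  \sum_(S : {set 'I_(q + k)})
    binomial_det k (positions S) * binomial_det k (positions [set rev_ord x | x in S]).
Proof.
have -> : tilings k q k = matchings e (lower :|: upper).
  by rewrite -hexagonE.
rewrite (matchings_cut _ _ (@share_edge_sym k q k) (@share_edge_irr k q k)
  _ _ _ _ _ axis_down_inj axis_up_inj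
  axis_down_lower axis_up_upper lower_upper_disjoint axis_edge axis_crossing).
by rewrite natr_sum; apply: eq_bigr => S _; rewrite natrM card_lower card_upper.
Qed.

Lemma card_tilings_edge m :
  #|[set X in tilings k q k | [set axis_down m; axis_up m] \in X]|%:R =
  \sum_(S : {set 'I_(q + k)} | m \in S)
    binomial_det k (positions S) * binomial_det k (positions [set rev_ord x | x in S]).
Proof.
have -> : tilings k q k = matchings e (lower :|: upper).
  by rewrite -hexagonE.
rewrite (matchings_cut_edge _ _ (@share_edge_sym k q k) (@share_edge_irr k q k)
  _ _ _ _ _ axis_down_inj axis_up_inj
  axis_down_lower axis_up_upper lower_upper_disjoint axis_edge axis_crossing).
by rewrite natr_sum; apply: eq_bigr => S _; rewrite natrM card_lower card_upper.
Qed.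

Lemma central_trianglesE (m : 'I_(q + k)) : m = (q + k)./2 :> nat ->
  central_triangles k q = [set axis_down m; axis_up m].
Proof.
move=> mE; apply/setP => -[[x y] u]; rewrite !inE /= -mE !xpair_eqE -!val_eqE /=.
case: u; rewrite /= !inE !xpair_eqE; lia.
Qed.
End Trapezoid.

(** * The moment identity and its symmetries *)
Section Kernel.
Local Open Scope ring_scope.
Implicit Types (F G A B P U V : {poly rat}).

Local Notation Y := (1 + 'X : {poly rat}).

Lemma dvdp_derivn F G n m : F ^+ (n + m) %| G -> F ^+ n %| G^`(m).
Proof.
elim: m G => [|m IHm] G; first by rewrite addn0 derivn0.
rewrite derivSn addnS => /dvdpP[Q ->]; apply: IHm.
rewrite derivM deriv_exp /=; apply: dvdp_add.
  by rewrite exprS; apply/dvdp_mull/dvdp_mull.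
by rewrite -mulrnAl; apply/dvdp_mull/dvdp_mull.
Qed.

Lemma eq_poly_but_one F G (bad : rat) :
  (forall a, a != bad -> F.[a] = G.[a]) -> F = G.
Proof.
move=> eqFG; apply/eqP; rewrite -subr_eq0; apply/eqP.
pose s := [seq bad + 1 + i%:R | i <- iota 0 (size (F - G))].
apply: (@roots_geq_poly_eq0 _ _ s); last by rewrite size_map size_iota.
  apply/allP => _ /mapP[i _ ->]; rewrite rootE hornerD hornerN subr_eq0.
  by apply/eqP/eqFG; rewrite -addrA addrC -subr_eq0 addrK nat1r pnatr_eq0.
rewrite map_inj_uniq ?iota_uniq // => i j /addrI /eqP.
by rewrite eqr_nat => /eqP.
Qed.

Lemma coef_Yn n i : (Y ^+ n)`_i = 'C(n, i)%:R.
Proof.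
have -> : Y ^+ n = \poly_(j < n.+1) 'C(n, j)%:R.
  rewrite poly_def exprDn; apply: eq_bigr => j _.
  by rewrite expr1n mul1r scaler_nat.
by rewrite coef_poly ltnS; case: leqP => // /bin_small ->.
Qed.

Lemma size_Y : size Y = 2.
Proof. by rewrite addrC size_XaddC. Qed.

Lemma Y_neq0 : Y != 0.
Proof. by rewrite -size_poly_eq0 size_Y. Qed.

Lemma size_Yn n : size (Y ^+ n) = n.+1.
Proof.
by rewrite polySpred ?expf_neq0 ?Y_neq0 // size_exp size_Y mul1n.
Qed.

(** The derivative of order M of z^(2M) B is divisible by z^M and, as it is also
    that of (1 + z)^(2M+1) P, by (1 + z)^(M+1); its degree is at most 2 M, so it
    is zero. *)
Lemma gap_unique M A B P :
  (size A <= M)%N -> (size B <= M.+1)%N -> (size P <= M)%N ->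
  Y ^+ (2 * M).+1 * P = A + B * 'X^(2 * M) -> [/\ P = 0, A = 0 & B = 0].
Proof.
move=> sA sB sP eqY.
pose D := (B * 'X^(2 * M))^`(M).
have D0 : D = 0.
  have X_D : 'X^M %| D.
    by apply: dvdp_derivn; rewrite addnn -mul2n dvdp_mull.
  have Y_D : Y ^+ M.+1 %| D.
    have -> : D = (Y ^+ (2 * M).+1 * P)^`(M).
      by rewrite eqY derivnD [A^`(M)]derivn_poly0 ?add0r.
    by apply: dvdp_derivn; rewrite addSn addnn -mul2n dvdp_mulr.
  have XY_D : 'X^M * Y ^+ M.+1 %| D.
    rewrite Gauss_dvdp ?X_D //; apply: coprimep_expl; apply: coprimep_expr.
    by rewrite coprimep_sym coprimepX rootE !hornerE oner_eq0.
  apply/eqP; apply: contraTT XY_D => D0; apply/negP => /(dvdp_leq D0).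
  rewrite size_mul ?expf_neq0 ?polyX_eq0 ?Y_neq0 // size_polyXn size_Yn /=.
  have : (size D <= (2 * M).+1)%N.
    apply/leq_sizeP => j lej; rewrite coef_derivn coefMXn.
    rewrite [B`_ _]nth_default ?if_same ?mul0rn //.
    by apply: leq_trans sB _; lia.
  move=> sD; apply/negP; rewrite -ltnNge; apply: leq_ltn_trans sD _; lia.
have B0 : B = 0.
  apply/polyP => j; rewrite coef0.
  have /polyP/(_ (M + j)%N) := D0; rewrite coef_derivn coefMXn coef0.
  have -> : (M + (M + j) < 2 * M)%N = false by lia.
  rewrite (_ : M + (M + j) - 2 * M = j)%N; last by lia.
  by move/eqP; rewrite mulrn_eq0 eqn0Ngt ffact_gt0 leq_addr /= => /eqP.
move: eqY; rewrite B0 mul0r addr0 => eqY.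
have P0 : P = 0.
  apply/eqP; apply: contraLR sA => P0; rewrite -eqY -ltnNge.
  rewrite size_mul ?expf_neq0 ?Y_neq0 // size_Yn; rewrite -size_poly_gt0 in P0.
  lia.
by split=> //; rewrite -eqY P0 mulr0.
Qed.

(** The form of degree d associated with F, evaluated at (U, V); this is how a
    change of projective coordinate acts on F. *)
Definition homogenize d F U V := \sum_(l < d.+1) F`_l *: (U ^+ l * V ^+ (d - l)).

Lemma size_homogenize d F U V : (size U <= 2)%N -> (size V <= 2)%N ->
  (size (homogenize d F U V) <= d.+1)%N.
Proof.
move=> sU sV; apply: leq_trans (size_sum _ _ _) _; apply/bigmax_leqP => l _.
apply: leq_trans (size_scale_leq _ _) _; apply: leq_trans (size_polyMleq _ _) _.
have size_pow G n : (size G <= 2)%N -> (size (G ^+ n) <= n.+1)%N.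
  move=> sG; apply: leq_trans (size_poly_exp_leq _ _) _; rewrite ltnS.
  by case: (size G) sG => [|[|[|]]] //= _; rewrite ?mul0n ?mul1n.
have := leq_add (size_pow U l sU) (size_pow V (d - l)%N sV).
rewrite -subn1 leq_subLR => /leq_trans; apply.
have := ltn_ord l; lia.
Qed.

Lemma horner_homogenize d F U V a b : (size F <= d.+1)%N -> U.[a] = b * V.[a] ->
  (homogenize d F U V).[a] = V.[a] ^+ d * F.[b].
Proof.
move=> sF Ua; rewrite horner_sum (horner_coef_wide _ sF) mulr_sumr.
apply: eq_bigr => l _; rewrite hornerZ hornerM !horner_exp Ua exprMn.
have -> : V.[a] ^+ d = V.[a] ^+ l * V.[a] ^+ (d - l).
  by rewrite -exprD subnKC // -ltnS.
by ring.
Qed.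

(** The coefficients of degrees M, ..., 2 M - 1 of the left-hand side are those of
    z^M (1 + z)^M: this is the linear system for the coefficients of P. Allowing
    degree M in B leaves the coefficient of z^(2M) free, which makes the system
    square; symmetry will show that B has no constant term. *)
Definition moment_identity M A B P :=
  Y ^+ (2 * M).+1 * P = A + 'X^M * Y ^+ M + B * 'X^(2 * M).

Lemma coef_Yn_mul N M P i : (size P <= M.+1)%N -> (M <= i)%N ->
  (Y ^+ N * P)`_i = \sum_(l < M.+1) P`_l * 'C(N, i - l)%:R.
Proof.
move=> sP leMi; rewrite mulrC coefM.
rewrite (big_ord_widen i.+1 (fun l => P`_l * 'C(N, i - l)%:R)) // [RHS]big_mkcond /=.
apply: eq_bigr => l _; rewrite coef_Yn; case: ltnP => // ltMl.
by rewrite nth_default ?mul0r //; apply: leq_trans ltMl.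
Qed.

Lemma split_gap M F : (size F <= 3 * M + 1)%N ->
  (forall i, (i < M)%N -> F`_(M + i) = 0) ->
  exists A B, [/\ (size A <= M)%N, (size B <= M.+1)%N & F = A + B * 'X^(2 * M)].
Proof.
move=> sF gap; exists (take_poly M F), (drop_poly (2 * M) F); split.
- exact: size_take_poly.
- by rewrite size_drop_poly leq_subLR; apply: leq_trans sF _; lia.
apply/polyP => i; rewrite coefD coefMXn coef_take_poly coef_drop_poly.
case: (ltnP i M) => [ltiM|leMi].
  have -> : (i < 2 * M)%N by lia.
  by rewrite addr0.
case: ltnP => [lti2M|le2Mi]; last by rewrite add0r subnK.
rewrite addr0 -(subnKC leMi) gap //; lia.
Qed.

(** Injectivity of the square linear system is [gap_unique]. *)
Lemma moment_identity_exists m (M := m.+1) : exists A B P,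
  [/\ (size A <= M)%N, (size B <= M.+1)%N, (size P <= M)%N & moment_identity M A B P].
Proof.
pose H : 'M[rat]_M := \matrix_(i, j) 'C((2 * M).+1, i + j + 1)%:R.
pose PP (v : 'cV[rat]_M) : {poly rat} := \poly_(l < M) v (inord (m - l)) 0.
have coefPP v i : (i < M)%N ->
    (Y ^+ (2 * M).+1 * PP v)`_(M + i) = (H *m v) (inord i) 0.
  move=> ltiM; rewrite (@coef_Yn_mul _ m) ?size_poly //; last by rewrite /M; lia.
  rewrite (reindex_inj rev_ord_inj) mxE; apply: eq_bigr => j _ /=.
  have ltj := ltn_ord j.
  rewrite coef_poly mxE inordK // mulrC (_ : (_ < M)%N); last by rewrite /M; lia.
  congr ('C(_, _)%:R * v _ 0); first by rewrite /M; lia.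
  by apply: val_inj; rewrite /= inordK subSS ?subKn // ltnS ?leq_subr // -ltnS.
have H_unit : H \in unitmx.
  rewrite unitmxE unitfE -det_tr; apply/det0P => -[v v0 vH].
  have vH' : H *m v^T = 0 by rewrite -[H]trmxK -trmx_mul vH trmx0.
  have sF : (size (Y ^+ (2 * M).+1 * PP v^T)%R <= 3 * M + 1)%N.
    apply: leq_trans (size_polyMleq _ _) _; rewrite size_Yn.
    have : (size (PP v^T) <= M)%N by exact: size_poly.
    by rewrite /= => /(leq_add (leqnn _))/leq_trans; apply; rewrite /M; lia.
  have [i ltiM|A [B [sA sB eqAB]]] := split_gap _ _ sF.
    by rewrite coefPP // vH' mxE.
  have [] := gap_unique _ _ _ _ sA sB (size_poly _ _) eqAB.
  move=> /polyP PP0 _ _; case/eqP: v0; apply/rowP => j.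
  have := PP0 (m - j)%N; rewrite coef_poly coef0 !mxE ltnS leq_subr.
  rewrite (_ : inord _ = j) //; apply: val_inj.
  by rewrite /= inordK subKn // ?ltnS ?leq_subr // -ltnS.
pose b : 'cV[rat]_M := \col_i 'C(M, i)%:R.
pose P := PP (invmx H *m b).
pose F := Y ^+ (2 * M).+1 * P - 'X^M * Y ^+ M.
have sF : (size F <= 3 * M + 1)%N.
  apply: leq_trans (size_polyD _ _) _; rewrite size_polyN geq_max.
  apply/andP; split; apply: leq_trans (size_polyMleq _ _) _.
    rewrite size_Yn; have : (size P <= M)%N by exact: size_poly.
    by rewrite /= => /(leq_add (leqnn _))/leq_trans; apply; rewrite /M; lia.
  by rewrite size_Yn size_polyXn; lia.
have [i ltiM|A [B [sA sB eqAB]]] := split_gap _ _ sF.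
  rewrite coefB coefPP // mulKVmx // mxE inordK // coefXnM.
  by rewrite ltnNge leq_addr /= addKn coef_Yn subrr.
exists A, B, P; split=> //; first exact: size_poly.
by rewrite /moment_identity addrAC -eqAB subrK.
Qed.

Lemma moment_identity_unique M A B P A' B' P' :
  (size A <= M)%N -> (size B <= M.+1)%N -> (size P <= M)%N ->
  (size A' <= M)%N -> (size B' <= M.+1)%N -> (size P' <= M)%N ->
  moment_identity M A B P -> moment_identity M A' B' P' -> [/\ P = P', A = A' & B = B'].
Proof.
move=> sA sB sP sA' sB' sP' eqP eqP'.
have sizeB F G n : (size F <= n)%N -> (size G <= n)%N -> (size (F - G)%R <= n)%N.
  move=> sF sG; apply: leq_trans (size_polyD _ _) _.
  by rewrite size_polyN geq_max sF.
have [] := gap_unique _ _ _ _ (sizeB _ _ _ sA sA') (sizeB _ _ _ sB sB')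
  (sizeB _ _ _ sP sP') _.
  by rewrite mulrBr eqP eqP'; ring.
by move=> /subr0_eq -> /subr0_eq -> /subr0_eq ->.
Qed.

Lemma horner_moment_identity M A B P a : moment_identity M A B P ->
  (1 + a) ^+ (2 * M).+1 * P.[a] =
  A.[a] + a ^+ M * (1 + a) ^+ M + B.[a] * a ^+ (2 * M).
Proof. by move/(congr1 (horner^~ a)); rewrite !hornerE. Qed.

(** The change of coordinate z := - z / (1 + z), which fixes 0 and exchanges -1 and
    infinity, exchanges A and P. The sign of z^M (1 + z)^M changes because M is
    odd; this is where the parity of the hexagon enters. *)
Lemma moment_identity_swap_infty_m1 m A B P (M := m.+1) : ~~ odd m ->
  (size A <= M)%N -> (size B <= M.+1)%N -> (size P <= M)%N ->
  moment_identity M A B P ->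
  moment_identity M (homogenize m P (-'X) Y) (- homogenize M B (-'X) Y)
    (homogenize m A (-'X) Y).
Proof.
move=> even_m sA sB sP eqAB; apply: (@eq_poly_but_one _ _ (-1)) => a a1.
have a1' : 1 + a != 0 by rewrite addrC -[1]opprK subr_eq0.
pose b := - a / (1 + a).
have Ua : (- 'X : {poly rat}).[a] = b * Y.[a] by rewrite !hornerE divfK.
have := horner_moment_identity _ _ _ _ b eqAB.
rewrite !hornerE !(horner_homogenize _ _ _ _ _ b) // !hornerE.
have -> : 1 + b = (1 + a)^-1 by rewrite /b; field.
move: A.[b] B.[b] P.[b] => A1 B1 P1.
have e1 (z : rat) : z ^+ M = z * z ^+ m by rewrite exprS.
have e2 (z : rat) : z ^+ (2 * M) = (z * z ^+ m) ^+ 2 by rewrite mulnC exprM e1.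
have e3 (z : rat) : z ^+ (2 * M).+1 = z * (z * z ^+ m) ^+ 2 by rewrite exprS e2.
have bm : b ^+ m = a ^+ m / (1 + a) ^+ m.
  by rewrite exprMn exprVn exprNn -signr_odd (negPf even_m) expr0 mul1r.
rewrite !(e1, e2, e3) !exprVn bm /b => h.
have x0 : (1 + a) ^+ m != 0 by rewrite expf_neq0.
move: x0 h; move: (a ^+ m) ((1 + a) ^+ m) => y x x0 h.
have -> : P1 = (1 + a) * ((1 + a) * x) ^+ 2 * ((1 + a)^-1 * ((1 + a)^-1 * x^-1) ^+ 2 * P1).
  by field; rewrite x0.
rewrite h; change ((1 + a) * ((1 + a) * x) ^+ 2 * x * A1 =
  x * ((1 + a) * ((1 + a) * x) ^+ 2 *
   (A1 + - a / (1 + a) * (y / x) * ((1 + a)^-1 / x) +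
    B1 * (- a / (1 + a) * (y / x)) ^+ 2)) +
  a * y * ((1 + a) * x) + - ((1 + a) * x * B1) * (a * y) ^+ 2).
by field; rewrite x0.
Qed.

(** The change of coordinate z := 1 / z, which exchanges 0 and infinity, exchanges
    A and B and reverses P. *)
Lemma moment_identity_swap_0_infty m A B P (M := m.+1) :
  (size A <= M)%N -> (size B <= M.+1)%N -> (size P <= M)%N ->
  moment_identity M A B P ->
  moment_identity M (homogenize M B 1 'X) ('X * homogenize m A 1 'X) (homogenize m P 1 'X).
Proof.
move=> sA sB sP eqAB; apply: (@eq_poly_but_one _ _ 0) => a a0.
pose b := a^-1.
have Ua : (1 : {poly rat}).[a] = b * 'X.[a] by rewrite !hornerE mulVf.
have := horner_moment_identity _ _ _ _ b eqAB.
rewrite !hornerE !(horner_homogenize _ _ _ _ _ b) // !hornerE.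
have -> : 1 + b = (1 + a) / a by rewrite /b; field.
move: A.[b] B.[b] P.[b] => A1 B1 P1.
have e1 (z : rat) : z ^+ M = z * z ^+ m by rewrite exprS.
have e2 (z : rat) : z ^+ (2 * M) = (z * z ^+ m) ^+ 2 by rewrite mulnC exprM e1.
have e3 (z : rat) : z ^+ (2 * M).+1 = z * (z * z ^+ m) ^+ 2 by rewrite exprS e2.
rewrite !(e1, e2, e3) !exprMn /b !exprVn => h.
have y0 : a ^+ m != 0 by rewrite expf_neq0.
move: y0 h; move: (a ^+ m) ((1 + a) ^+ m) => y x y0 h.
change ((1 + a) * ((1 + a) ^+ 2 * x ^+ 2) * y * P1 =
  a * y * B1 + a * y * ((1 + a) * x) + a * y * A1 * (a ^+ 2 * y ^+ 2)).
transitivity (a ^+ 3 * y ^+ 3 *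
  ((1 + a) / a * ((1 + a) ^+ 2 / a ^+ 2 * (x ^+ 2 / y ^+ 2)) * P1)).
  by field; rewrite ?y0 ?a0.
by rewrite h; field; rewrite ?y0 ?a0.
Qed.

(** The coefficient of z^n in (1 + z)^(-e). The predecessor is harmless: for e = 0
    the binomial coefficient is C(n - 1, n), which is 1 for n = 0 and 0 for
    n > 0. *)
Definition negbin e n : rat := (-1) ^+ n * 'C((e + n).-1, n)%:R.

(** The coefficient of z^M in the power series F / (1 + z)^e. *)
Definition coef_div_Yn M e F := \sum_(i < M.+1) F`_i * negbin e (M - i).

Lemma negbin_rec e n : negbin e.+1 n.+1 + negbin e.+1 n = negbin e n.+1.
Proof.
by rewrite /negbin !addSn !addnS /= binS natrD exprS; ring.
Qed.

Lemma coef_div_Yn0 M F : coef_div_Yn M 0 F = F`_M.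
Proof.
rewrite /coef_div_Yn big_ord_recr /= subnn /negbin /= bin0 expr0 !mulr1.
rewrite big1 ?add0r // => i _; rewrite bin_small ?mulr0 //.
have := ltn_ord i; lia.
Qed.

Lemma coef_div_YnD M e F G : coef_div_Yn M e (F + G) = coef_div_Yn M e F + coef_div_Yn M e G.
Proof.
by rewrite -big_split /=; apply: eq_bigr => i _; rewrite coefD mulrDl.
Qed.

Lemma coef_div_YnZ M e a F : coef_div_Yn M e (a *: F) = a * coef_div_Yn M e F.
Proof.
by rewrite mulr_sumr; apply: eq_bigr => i _; rewrite coefZ mulrA.
Qed.

Lemma coef_div_Yn_sum M e n (F : 'I_n -> {poly rat}) :
  coef_div_Yn M e (\sum_(l < n) F l) = \sum_(l < n) coef_div_Yn M e (F l).
Proof.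
apply: (big_morph _ (coef_div_YnD M e)).
by apply: big1 => i _; rewrite coef0 mul0r.
Qed.

Lemma coef_div_Yn_mulY M e F : coef_div_Yn M e.+1 (Y * F) = coef_div_Yn M e F.
Proof.
rewrite mulrDl mul1r coef_div_YnD /coef_div_Yn [in RHS]big_ord_recr /=.
rewrite [X in X + _]big_ord_recr [X in _ + X]big_ord_recl /=.
rewrite !subnn coefXM mul0r add0r addrAC -big_split /=; congr (_ + _).
  apply: eq_bigr => i _; rewrite coefXM /= -mulrDr.
  by rewrite /bump add1n /= -(subnSK (ltn_ord i)) negbin_rec.
by rewrite /negbin !bin0.
Qed.

Lemma coef_div_Yn_mulYn M e n F : coef_div_Yn M (n + e) (Y ^+ n * F) = coef_div_Yn M e F.
Proof.
elim: n => [|n IHn]; first by rewrite mul1r.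
by rewrite exprS -mulrA addSn coef_div_Yn_mulY.
Qed.

Lemma coef_div_Yn_Xn M e n : (n <= M)%N -> coef_div_Yn M e 'X^n = negbin e (M - n).
Proof.
move=> lenM; have ltnM : (n < M.+1)%N by [].
rewrite /coef_div_Yn (bigD1 (Ordinal ltnM)) //= coefXn eqxx mul1r big1 ?addr0 //.
move=> i /eqP ni; rewrite coefXn; case: eqP => [ni'|]; last by rewrite mul0r.
by case: ni; apply: val_inj.
Qed.

(** Take the coefficient of z^M in the moment identity divided by (1 + z)^M. With
    g the last sum, the term in P gives 2 g since P is palindromic, the term in A
    gives - g since A is the transform of P that exchanges -1 and infinity, the
    monomial gives 1 and the term in B gives 0: hence 2 g = - g + 1. *)
Lemma one_third_moments m (M := m.+1) : ~~ odd m ->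
  exists c : nat -> rat,
    (forall i, (i <= M)%N ->
       \sum_(j < M) c j * 'C((2 * M).+1, i + j + 1)%:R = 'C(M, i)%:R)
    /\ \sum_(j < M) c j * 'C(M, j)%:R = 3%:R^-1.
Proof.
move=> even_m.
have [A [B [P [sA sB sP eqAB]]]] := moment_identity_exists m; rewrite -/M in sA sB sP eqAB.
have sX : (size (- 'X : {poly rat}) <= 2)%N by rewrite size_polyN size_polyX.
have sX' : (size ('X : {poly rat}) <= 2)%N by rewrite size_polyX.
have sY : (size Y <= 2)%N by rewrite size_Y.
have s1 : (size (1%R : {poly rat}) <= 2)%N by rewrite size_poly1.
have [PA AP BB] : [/\ P = homogenize m A (- 'X) Y, A = homogenize m P (- 'X) Y
                    & B = - homogenize M B (- 'X) Y].
  apply: (moment_identity_unique M) => //; rewrite ?size_polyN ?size_homogenize //.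
  exact: moment_identity_swap_infty_m1.
have B0 : B`_0 = 0.
  have : B`_0 = - B`_0.
    rewrite {1}BB coefN coef_sum big_ord_recl /= subn0 mul1r coefZ coef_Yn bin0 mulr1.
    by rewrite big1 ?addr0 // => i _; rewrite /= exprS -mulrA mulNr coefZ coefN coefXM mulrN mulr0 oppr0.
  by move/eqP; rewrite -addr_eq0 -mulr2n mulrn_eq0 => /eqP.
have [PP _ _] : [/\ P = homogenize m P 1 'X, A = homogenize M B 1 'X & B = 'X * homogenize m A 1 'X].
  apply: (moment_identity_unique M) => //; rewrite ?size_homogenize //.
  - rewrite /homogenize big_ord_recl /= B0 scale0r add0r.
    apply: leq_trans (size_sum _ _ _) _; apply/bigmax_leqP => l _.
    apply: leq_trans (size_scale_leq _ _) _; rewrite expr1n mul1r size_polyXn.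
    rewrite /bump /=; have := ltn_ord l; lia.
  - apply: leq_trans (size_polyMleq _ _) _.
    rewrite size_polyX add2n /= ltnS; exact: size_homogenize.
  exact: moment_identity_swap_0_infty.
have palP l : (l <= m)%N -> P`_(m - l) = P`_l.
  move=> lelm; rewrite {1}PP coef_sum.
  have ltlm : (l < m.+1)%N by [].
  rewrite (bigD1 (Ordinal ltlm)) //= expr1n mul1r coefZ coefXn eqxx mulr1.
  rewrite big1 ?addr0 // => i il; rewrite expr1n mul1r coefZ coefXn.
  case: eqP => [eqi|_]; last by rewrite mulr0.
  case/eqP: il; apply: val_inj => /=; have := ltn_ord i; lia.
(* P is palindromic, so its coefficients may be read in either order. *)
exists (fun j => P`_j); split => [i leiM|].
  transitivity ((Y ^+ (2 * M).+1 * P)`_(M + i)).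
    rewrite (@coef_Yn_mul _ m) //; last by rewrite /M; lia.
    rewrite (reindex_inj rev_ord_inj); apply: eq_bigr => j _ /=.
    have ltj := ltn_ord j; rewrite subSS palP //; congr (_ * 'C(_, _)%:R).
    have eM : M = m.+1 by [].
    by move: ltj eM; move: (nat_of_ord j) => a; clearbody M; lia.
  rewrite eqAB !coefD coefXnM coefMXn ltnNge leq_addr /= addKn coef_Yn.
  rewrite nth_default; last by apply: leq_trans sA (leq_addr _ _).
  rewrite add0r; case: ltnP => [_|le2M]; first by rewrite addr0.
  by rewrite (_ : M + i - 2 * M = 0)%N ?B0 ?addr0 //; lia.
set g := \sum_(j < M) _.
have gA : coef_div_Yn M M A = - g.
  rewrite {1}AP coef_div_Yn_sum -sumrN; apply: eq_bigr => l _.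
  have lelm : (l <= m)%N by rewrite -ltnS.
  rewrite coef_div_YnZ -mulrN; congr (_ * _).
  have eM : M = (m - l + l.+1)%N by rewrite /M; lia.
  have signP : (-1) ^+ l = ((-1) ^+ l)%:P :> {poly rat}.
    by rewrite rmorphXn /= rmorphN1.
  rewrite exprNn signP -mulrA mul_polyC coef_div_YnZ.
  have -> : coef_div_Yn M M ('X^l * Y ^+ (m - l)) = negbin l.+1 (M - l).
    by rewrite mulrC {2}eM coef_div_Yn_mulYn coef_div_Yn_Xn // ltnW.
  rewrite /negbin mulrA -exprD subnKC; last by rewrite ltnW.
  rewrite addSn subnKC /=; last by rewrite ltnW.
  by rewrite bin_sub ?(ltnW (ltn_ord l)) // -signr_odd /= even_m expr1 mulN1r.
have := congr1 (coef_div_Yn M M) eqAB; rewrite !coef_div_YnD gA.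
have -> : coef_div_Yn M M (Y ^+ (2 * M).+1 * P) = g + g.
  have -> : (2 * M).+1 = (M + M.+1)%N by lia.
  rewrite exprD -mulrA -{2}[M]addn0 coef_div_Yn_mulYn coef_div_Yn0 (@coef_Yn_mul _ m) //.
  have gE : g = \sum_(l < m.+1) P`_l * 'C(M, m - l)%:R.
    rewrite [RHS](reindex_inj rev_ord_inj); apply: eq_bigr => l _ /=.
    have lelm : (l <= m)%N by rewrite -ltnS.
    by rewrite subSS subKn // palP.
  rewrite {2}gE /g -big_split /=; apply: eq_bigr => l _.
  have lelm : (l <= m)%N by rewrite -ltnS.
  by rewrite -mulrDr -natrD -(bin_sub (ltnW (ltn_ord l))) /M subSn // -binS.
have -> : coef_div_Yn M M ('X^M * Y ^+ M) = 1.
  by rewrite mulrC -{2}[M]addn0 coef_div_Yn_mulYn coef_div_Yn0 coefXn eqxx.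
have -> : coef_div_Yn M M (B * 'X^(2 * M)) = 0.
  apply: big1 => i _; rewrite coefMXn (_ : (i < 2 * M)%N) ?mul0r //.
  by apply: leq_trans (ltn_ord i) _; rewrite /M; lia.
by move=> eg; lra.
Qed.
End Kernel.

(** * One third *)
Lemma sum_bin_mul_bin n i j :
  \sum_(x < n) 'C(x, i) * 'C(n - x.+1, j) = 'C(n, i + j + 1).
Proof.
elim: n j => [|n IHn] j; first by rewrite big_ord0 bin_small // addn1.
rewrite big_ord_recr /= subnn.
case: j => [|j].
  have := IHn 0; rewrite bin0 muln1 addn0 addn1 binS => <-.
  by congr (_ + _); apply: eq_bigr => x _; rewrite !bin0.
have := IHn j.+1; have := IHn j; rewrite bin0n muln0 addn0.
rewrite -[i + j + 1]addnA [j + 1]addn1 [i + j.+1 + 1]addn1 binS => <- <-.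
rewrite -big_split /=; apply: eq_bigr => x _.
by rewrite -mulnDr subSS -(subnSK (ltn_ord x)) binS.
Qed.

Section OneThird.
Local Open Scope ring_scope.

(** Two factorizations of the same block matrix into triangular ones. *)
Lemma det_sub_rank1 n (v : 'cV[rat]_n) (w : 'rV[rat]_n) :
  \det (1%:M - v *m w) = 1 - (w *m v) 0 0.
Proof.
pose X : 'M[rat]_(1 + n) := block_mx 1%:M w v 1%:M.
have -> : \det (1%:M - v *m w) = \det X.
  have -> : X = block_mx 1%:M 0 v 1%:M *m block_mx 1%:M w 0 (1%:M - v *m w).
    rewrite mulmx_block !mul1mx !mulmx1 !mul0mx !addr0.
    by rewrite addrC subrK.
  by rewrite det_mulmx det_lblock det_ublock !det1 !mul1r.
have -> : X = block_mx (1%:M - w *m v) w 0 1%:M *m block_mx 1%:M 0 v 1%:M.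
  by rewrite mulmx_block !mul1mx !mulmx1 !mul0mx !mulmx0 !add0r subrK.
by rewrite det_mulmx det_lblock det_ublock !det1 !mulr1 det_mx11 !mxE.
Qed.

(** The tilings without the central lozenge are counted by the moment matrix with
    the middle position omitted, that is, by H - b b^T = H (1 - c b^T). *)
Lemma central_third m k q (M := m.+1) : ~~ odd m ->
  (M <= k <= M.+1)%N -> (q + k = (2 * M).+1)%N ->
  (3 * #|central_tilings k q|)%N = #|tilings k q k|.
Proof.
move=> even_m /andP[leMk lekM] qk.
have k_gt0 : (0 < k)%N by apply: leq_trans leMk.
have ltM : (M < q + k)%N by rewrite qk; lia.
pose mid : 'I_(q + k) := Ordinal ltM.
have [c [c_mom c_third]] := one_third_moments m even_m.
rewrite -/M in c_mom c_third.
apply/eqP; rewrite -(eqr_nat rat) natrM; apply/eqP.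
have -> : central_tilings k q =
    [set X in tilings k q k | [set axis_down k q k_gt0 mid; axis_up k q k_gt0 mid] \in X].
  rewrite /central_tilings (central_trianglesE k q k_gt0 mid) //=; rewrite qk; lia.
rewrite card_tilings_edge // card_tilings //.
pose h (S : {set 'I_(q + k)}) :=
  binomial_det k (positions S) * binomial_det k (positions [set rev_ord x | x in S]).
rewrite -[X in _ * X]/(\sum_(S : {set 'I_(q + k)} | mid \in S) h S).
rewrite -[RHS]/(\sum_(S : {set 'I_(q + k)}) h S).
pose moment (Q : {set 'I_(q + k)}) : 'M[rat]_k :=
  \matrix_(i, j) \sum_(x in Q) 'C(x, i)%:R * 'C(q + k - x.+1, j)%:R.
have [sg sumQ] : exists sg : rat, forall Q : {set 'I_(q + k)},
    \sum_(S : {set 'I_(q + k)} | S \subset Q) h S = sg * \det (moment Q).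
  by eexists => Q; apply: sum_binomial_det.
pose b : 'cV[rat]_k := \col_i 'C(M, i)%:R.
pose v : 'cV[rat]_k := \col_i (if (i < M)%N then c i else 0).
have v_sum (f : nat -> rat) : \sum_(j < k) f j * v j 0 = \sum_(j < M) c j * f j.
  rewrite (big_ord_widen k (fun j => c j * f j)) // [RHS]big_mkcond /=.
  apply: eq_bigr => j _; rewrite mxE mulrC.
  by case: ifP; rewrite ?mul0r.
have momT i j : moment setT i j = 'C((2 * M).+1, i + j + 1)%:R.
  rewrite mxE -qk -sum_bin_mul_bin natr_sum /=.
  by apply: eq_big => [x|x _]; rewrite ?inE ?natrM.
have momv : moment setT *m v = b.
  apply/matrixP => i j; rewrite ord1 !mxE.
  under eq_bigr do rewrite momT.
  rewrite (v_sum (fun j => 'C((2 * M).+1, i + j + 1)%:R)) c_mom //.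
  by rewrite -ltnS; apply: leq_trans (ltn_ord i) lekM.
have momC : moment (~: [set mid]) = moment setT *m (1%:M - v *m b^T).
  rewrite mulmxBr mulmx1 mulmxA momv; apply/matrixP => i j.
  rewrite !mxE big_ord1 !mxE [in RHS](bigD1 mid) ?in_setT //=.
  rewrite (_ : (q + k - M.+1 = M)%N); last by rewrite qk; lia.
  rewrite addrAC subrr add0r; apply: eq_bigl => x; by rewrite !inE.
have detC : \det (moment (~: [set mid])) = \det (moment setT) * (1 - 3%:R^-1).
  rewrite momC det_mulmx det_sub_rank1; congr (_ * (1 - _)).
  rewrite mxE -c_third -(v_sum (fun j => 'C(M, j)%:R)); apply: eq_bigr => j _.
  by rewrite !mxE.
have tot : \sum_(S : {set 'I_(q + k)}) h S = sg * \det (moment setT).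
  by rewrite -sumQ; apply: eq_bigl => S; rewrite subsetT.
rewrite tot.
have := tot; rewrite (bigID (fun S : {set 'I_(q + k)} => mid \in S)) /=.
have -> : \sum_(S : {set 'I_(q + k)} | mid \notin S) h S =
    sg * \det (moment (~: [set mid])).
  rewrite -sumQ; apply: eq_bigl => S.
  by rewrite -disjoints_subset disjoint_sym disjoints1.
rewrite detC => totE; have -> := canRL (addrK _) totE.
by field.
Qed.
End OneThird.

Theorem theorem17 (n : nat) (hn : 1 <= n) :
  3 * #|central_tilings (2 * n - 1) (2 * n)|
    = #|tilings (2 * n - 1) (2 * n) (2 * n - 1)|
  /\
  3 * #|central_tilings (2 * n) (2 * n - 1)|
    = #|tilings (2 * n) (2 * n - 1) (2 * n)|.
Proof.
have even_m : ~~ odd (2 * n - 2) by lia.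
by split; apply: central_third even_m _ _; lia.
Qed.
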